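(* Let $v$ be a submultiplicative weight on $\mathbb{R}^d$. Then the following conditions are equivalent: (1) $v$ satisfies the GRS-condition, i.e. $\lim_{\ell\to\infty} v(\ell x)^{1/\ell}=1$ for every $x\in\mathbb{R}^d$; (2) for every $\varepsilon>0$ there is a constant $C_\varepsilon>0$ such that $v(x)\le C_\varepsilon e^{\varepsilon|x|}$ for all $x\in\mathbb{R}^d$.
   Context: A weight on $\mathbb{R}^d$ is a positive function on $\mathbb{R}^d$ belonging to $L^\infty_{loc}(\mathbb{R}^d)$. A weight $v$ on $\mathbb{R}^d$ is submultiplicative if it is even and satisfies $v(x+y)\le v(x)v(y)$ for all $x,y\in\mathbb{R}^d$. In the GRS-condition, $\ell$ runs over positive integers. Here $|x|$ is the Euclidean norm. *)

(* Defs.v *)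
From HB Require Import structures.
From mathcomp Require Import all_boot all_order all_algebra.
From mathcomp Require Import all_classical all_reals all_analysis.

Set Implicit Arguments.
Unset Strict Implicit.
Unset Printing Implicit Defensive.
Import Order.TTheory GRing.Theory Num.Theory.
Import numFieldNormedType.Exports.

Local Open Scope classical_set_scope.
Local Open Scope ring_scope.

(* MathComp-Analysis has Lebesgue measure on R only; it is built here on
   'rV[R]_d from the usual outer measure by Caratheodory's construction. *)
Section lebesgue_measure_rV.
Context {R : realType} {d : nat}.

Definition box (a b : 'rV[R]_d) : set 'rV[R]_d :=
  [set x | forall i, a ord0 i <= x ord0 i <= b ord0 i].

(* [box a b] is empty as soon as some [b ord0 i < a ord0 i]; the corresponding
   factor is then 0. *)
Definition box_volume (a b : 'rV[R]_d) : \bar R :=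
  (\prod_(i < d) Num.max 0 (b ord0 i - a ord0 i))%:E.

(* Covers are indexed by a subset of nat, so that finite and empty covers are
   allowed (for d = 0 there is no box of volume 0). *)
Definition box_cover (X : set 'rV[R]_d)
    (c : pred nat * (nat -> 'rV[R]_d * 'rV[R]_d)) : Prop :=
  X `<=` \bigcup_(k in [set k | c.1 k]) box (c.2 k).1 (c.2 k).2.

Definition lebesgue_outer_measure_rV (X : set 'rV[R]_d) : \bar R :=
  ereal_inf [set (\sum_(k <oo | c.1 k) box_volume (c.2 k).1 (c.2 k).2)%E
            | c in box_cover X].

Local Notation mu := lebesgue_outer_measure_rV.

Lemma box_volume_ge0 a b : (0 <= box_volume a b)%E.
Proof. by rewrite lee_fin; apply: prodr_ge0 => i _; rewrite le_max lexx. Qed.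

Lemma lebesgue_outer_measure_rV_ge0 X : (0 <= mu X)%E.
Proof.
apply: le_ereal_inf_tmp => _ [c _ <-].
by apply: nneseries_ge0 => n _ _; exact: box_volume_ge0.
Qed.

Lemma lebesgue_outer_measure_rV0 : mu set0 = 0%E.
Proof.
apply/eqP; rewrite eq_le lebesgue_outer_measure_rV_ge0 andbT.
apply: ereal_inf_lbound; exists (pred0 : pred nat, fun=> (0, 0)) => //=.
exact: eseries_pred0.
Qed.

Lemma le_lebesgue_outer_measure_rV : {homo mu : A B / A `<=` B >-> (A <= B)%E}.
Proof.
move=> A B AB; apply: ereal_inf_le_tmp => _ [c cB <-].
by exists c => //; exact: subset_trans cB.
Qed.

Local Open Scope ereal_scope.
Lemma lebesgue_outer_measure_rV_sigma_subadditive : sigma_subadditive mu.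
Proof.
move=> A; have [[i ioo]|] := pselect (exists i, mu (A i) = +oo).
  rewrite (eseries_pinfty _ _ ioo) ?leey// => n _.
  by rewrite -ltNye (lt_le_trans _ (lebesgue_outer_measure_rV_ge0 _)).
rewrite -forallNE => Aoo.
apply/lee_addgt0Pr => e e0.
rewrite (le_trans _ (epsilon_trick _ _ (ltW e0)))//; last first.
  by move=> n; exact: lebesgue_outer_measure_rV_ge0.
pose w (c : pred nat * (nat -> 'rV[R]_d * 'rV[R]_d)) k :=
  if c.1 k then box_volume (c.2 k).1 (c.2 k).2 else 0.
have w_ge0 c k : 0 <= w c k.
  by rewrite /w; case: ifP => // _; exact: box_volume_ge0.
have wE c : \sum_(k <oo | c.1 k) box_volume (c.2 k).1 (c.2 k).2 =
    \sum_(k <oo) w c k by rewrite [LHS]eseries_mkcond.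
have [G PG] : {G : nat -> _ & forall n, box_cover (A n) (G n) /\
    \sum_(k <oo) w (G n) k <= mu (A n) + (e / (2 ^ n.+1)%:R)%:E}.
  apply: (@choice _ _ (fun n c => box_cover (A n) c /\
    \sum_(k <oo) w c k <= mu (A n) + (e / (2 ^ n.+1)%:R)%:E)) => n.
  have fA : mu (A n) \is a fin_num.
    by rewrite ge0_fin_numE ?lebesgue_outer_measure_rV_ge0// ltey; exact/eqP.
  have en : (0 < e / (2 ^ n.+1)%:R)%R by rewrite divr_gt0// ltr0n expn_gt0.
  have [_ [c cA <-] /ltW cle] := lb_ereal_inf_adherent en fA.
  by exists c; rewrite -wE.
apply: (@le_trans _ _ (\sum_(i <oo) \sum_(j <oo) w (G i) j)); last first.
  apply: lee_nneseries => [i _ _|i _]; last exact: (PG i).2.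
  exact: nneseries_ge0.
have /card_esym/ppcard_eqP[f] := card_nat2.
pose c := ((fun k => (G (f k).1).1 (f k).2) : pred nat,
           fun k => (G (f k).1).2 (f k).2).
apply: (@le_trans _ _ (\sum_(k <oo) w c k)).
  rewrite -wE; apply: ereal_inf_lbound; exists c => //.
  move=> x [n _ /(PG n).1[k /= Gk xk]].
  by exists (f^-1%FUN (n, k)); rewrite /= invK ?inE.
pose g (p : nat * nat) := w (G p.1) p.2.
have g_ge0 p : 0 <= g p by exact: w_ge0.
rewrite [leLHS](_ : _ = \esum_(p in [set: nat * nat]) g p); last first.
  by rewrite -(esum_pred_image g f xpredT) ?[fun=> _]set_true// image_eq.
pose J : nat -> set (nat * nat) := fun i => [set (i, j) | j in setT].
rewrite (_ : setT = \bigcup_k J k); last first.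
  by rewrite predeqE => -[a b]; split => // _; exists a => //; exists b.
rewrite esum_bigcupT//; last first.
  apply/trivIsetP => i j _ _ ij.
  rewrite predeqE => -[n m] /=; split => //= -[] [_] _ [<-{n} _].
  by move=> [m' _] [] /esym/eqP; rewrite (negbTE ij).
rewrite -(image_id [set: nat]) -fun_true esum_pred_image//; last first.
  by move=> n _; exact: esum_ge0.
rewrite le_eqVlt; apply/orP; left; apply/eqP.
apply: eq_eseriesr => /= i _.
rewrite -(esum_pred_image g (pair i) predT)//=; last first.
  by move=> ? ? _ _; exact: (@can_inj _ _ _ snd).
by congr esum; rewrite predeqE => -[a b]; split; move=> [j _ <-]; exists j.
Qed.
Local Close Scope ereal_scope.

HB.instance Definition _ := isOuterMeasure.Build R 'rV[R]_d
  lebesgue_outer_measure_rV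
  lebesgue_outer_measure_rV0 lebesgue_outer_measure_rV_ge0
  le_lebesgue_outer_measure_rV lebesgue_outer_measure_rV_sigma_subadditive.

(* R^d with the sigma-algebra of Lebesgue measurable sets *)
Definition lebesgue_rV := caratheodory_type lebesgue_outer_measure_rV.

HB.instance Definition _ := Measurable.on lebesgue_rV.

Definition lebesgue_measure_rV : set lebesgue_rV -> \bar R :=
  lebesgue_outer_measure_rV.

HB.instance Definition _ := isMeasure.Build _ lebesgue_rV R lebesgue_measure_rV
  (@caratheodory_measure0 R _ lebesgue_outer_measure_rV)
  (@caratheodory_measure_ge0 R _ lebesgue_outer_measure_rV)
  (@caratheodory_measure_sigma_additive R _ lebesgue_outer_measure_rV).

End lebesgue_measure_rV.

Definition Linfty_loc {R : realType} {d : nat} (f : 'rV[R]_d -> R) : Prop :=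
  measurable_fun [set: @lebesgue_rV R d] f /\
  forall K : set 'rV[R]_d, compact K ->
    exists M : R, \forall x \ae lebesgue_measure_rV, K x -> `|f x| <= M.

Definition weight {R : realType} {d : nat} (v : 'rV[R]_d -> R) : Prop :=
  (forall x, 0 < v x) /\ Linfty_loc v.

Definition submultiplicative {R : realType} {d : nat} (v : 'rV[R]_d -> R)
    : Prop :=
  (forall x, v (- x) = v x) /\ (forall x y, v (x + y) <= v x * v y).

Definition GRS_condition {R : realType} {d : nat} (v : 'rV[R]_d -> R) : Prop :=
  forall x : 'rV[R]_d,
    (fun l : nat => v (l%:R *: x) `^ l%:R^-1) @ \oo --> (1 : R).

(* The library norm on 'rV[R]_d is the sup norm. *)
Definition euclidean_norm {R : realType} {d : nat} (x : 'rV[R]_d) : R :=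
  Num.sqrt (\sum_(i < d) x ord0 i ^+ 2).

(* Main.v *)
Require Import Defs.
From mathcomp Require Import all_boot all_order all_algebra.
From mathcomp Require Import all_classical all_reals all_analysis.
From mathcomp Require Import measurable_realfun lra.
Import Order.TTheory GRing.Theory Num.Theory.
Import numFieldNormedType.Exports.
Local Open Scope ring_scope.

(** Let [v] be a submultiplicative weight. Evenness gives
    [v x ^+ 2 = v x * v (- x) >= v 0 >= 1], so [v >= 1] everywhere.

    From a subexponential bound to the GRS-condition: [v (l *: x)] lies between
    [1] and [C * expR (eps * l * |x|)], and the [l]-th root of the upper bound
    tends to [expR (eps * |x|)], which is as close to [1] as wanted
    ([GRS_of_subexponential]).

    From the GRS-condition to a subexponential bound: work along one axis at a
    time. If [v (l *: e) <= expR (delta * l)] for one [l > 0],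
    then writing [t = r + q * l] with [0 <= r < l] gives
    [v (t *: e) <= v (r *: e) * expR (delta * l) ^+ q], so [v] grows at most
    like [expR (delta * t)] on the line spanned by [e], as soon as [v (r *: e)]
    is bounded for [0 <= r <= l] ([submultiplicative_line_growth]). Since [x] is
    the sum of its components along the axes, multiplying the [d] bounds gives
    [C * expR (delta * \sum_i |x_i|)], and [\sum_i |x_i| <= d * |x|]
    ([subexponential_of_GRS]).

    What remains is a true bound of [v] near the origin, where the weight is
    only assumed to be essentially bounded. If [v <= M] outside a null set [N],
    choose for each small [x] a point [y] of the unit cube such that neither
    [y] nor [x - y] lies in [N]; then [v x <= v y * v (x - y) <= M * M]
    ([weight_bounded_near0]). Such a [y] exists because the null sets [N] and
    [x - N] ([outer_measure_reflect_le]) cannot cover the unit cube, whose outer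
    measure is at least 1 ([unit_cube_outer_measure_ge1]). *)

(** * The outer measure of the unit cube *)

Section cube_measure.
Local Open Scope classical_set_scope.
Context {R : realType} {d : nat}.

Local Notation cube lo hi := (@box R d (const_mx lo) (const_mx hi)).

(** Integrate the inequality satisfied on the unit interval: an interval with
    weight [w k] contributes at most [w k] times its length. *)
Lemma unit_interval_cover_sum (w a b : nat -> R) :
  (forall k, 0 <= w k) ->
  (forall t, 0 <= t <= 1 ->
     (1 <= \sum_(k <oo) (w k * \1_(`[a k, b k]) t)%:E)%E) ->
  (1 <= \sum_(k <oo) (w k * Num.max 0 (b k - a k))%:E)%E.
Proof.
move=> w0 cov.
have mI (c e : R) : measurable (`[c, e] : set R) by exact: measurable_itv.
have mind k : measurable_fun (`[0, 1] : set R) (\1_(`[a k, b k]) : R -> R).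
  by apply: measurable_funTS; exact: measurable_indic.
have mterm k : measurable_fun (`[0, 1] : set R)
    (fun t : R => (w k * \1_(`[a k, b k]) t)%:E : \bar R).
  by apply/measurable_EFinP; exact: measurable_funM.
have t0 k t : (0 <= (w k * \1_(`[a k, b k]) t)%:E)%E.
  by rewrite lee_fin mulr_ge0.
have -> : 1%E = (\int[lebesgue_measure]_(t in `[0%R, 1%R]) cst 1 t)%E :> \bar R.
  by rewrite integral_cst//= lebesgue_measure_itv /= lte_fin ltr01 oppr0 adde0 mule1.
apply: (@le_trans _ _ (\int[lebesgue_measure]_(t in `[0%R, 1%R])
    \sum_(k <oo) (w k * \1_(`[a k, b k]) t)%:E)%E).
  apply: ge0_le_integral => //.
  by apply: ge0_emeasurable_sum => [k t _ _|k _]; [exact: t0|exact: mterm].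
rewrite integral_nneseries//.
apply: lee_nneseries => k _; first by move=> _; exact: integral_ge0.
under eq_integral do rewrite EFinM.
rewrite ge0_integralZl_EFin//; last exact/measurable_EFinP.
rewrite EFinM lee_pmul ?lee_fin//; first exact: integral_ge0.
rewrite integral_indic//.
apply: (@le_trans _ _ (lebesgue_measure (`[a k, b k] : set R))).
  by apply: le_measure; rewrite ?inE//; exact: measurableI.
rewrite lebesgue_measure_itv /= lte_fin.
case: ltP => ab; last by rewrite lee_fin le_max lexx.
by rewrite -EFinB lee_fin le_max lexx orbT.
Qed.

(** Bounding the volume of a countable cover from below usually relies on
    compactness; here it relies on integration along one coordinate at a time.
    Where the boxes cover the cube, the sum of their indicators is at least 1.
    The indicator of a box is a product over the coordinates; integrating over
    the [j]-th coordinate replaces its [j]-th factor by a length, and the lower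
    bound survives by [unit_interval_cover_sum]. After [d] integrations the
    terms of the sum are the volumes of the boxes. *)
Lemma unit_cube_outer_measure_ge1 :
  (1 <= lebesgue_outer_measure_rV (cube 0%R 1%R))%E.
Proof.
apply: le_ereal_inf_tmp => _ [[P c] cov <-] /=.
pose a k i := (c k).1 ord0 i; pose b k i := (c k).2 ord0 i.
(* The factor at coordinate [i] once the first [j] coordinates are integrated. *)
pose g (j : nat) (x : 'rV[R]_d) k (i : 'I_d) :=
  if (i < j)%N then Num.max 0 (b k i - a k i)
  else \1_(`[a k i, b k i]) (x ord0 i).
have g0 j x k i : 0 <= g j x k i.
  by rewrite /g; case: ifP => // _; rewrite le_max lexx.
suff H j : (j <= d)%N -> forall x, cube 0%R 1%R x ->
    (1 <= \sum_(k <oo) (if P k then \prod_i g j x k i else 0)%:E)%E.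
  have /(H d (leqnn d)) : cube 0%R 1%R (const_mx 0 : 'rV[R]_d).
    by move=> i; rewrite !mxE lexx ler01.
  move=> /le_trans; apply; rewrite [leRHS]eseries_mkcond.
  apply: lee_nneseries => k _; first by case: ifP => // _; rewrite lee_fin prodr_ge0.
  case: ifP => // _; rewrite lee_fin le_eqVlt; apply/orP; left; apply/eqP.
  by apply: eq_bigr => i _; rewrite /g ltn_ord.
elim: j => [_ x /cov [k /= Pk xk]|j IH jd x xbox].
  rewrite (@nneseriesD1 _ _ k)//; last first.
    by move=> n _; rewrite lee_fin; case: ifP => // _; exact: prodr_ge0.
  rewrite Pk big1 ?leeDl//.
    apply: nneseries_ge0 => n _ _; rewrite lee_fin.
    by case: ifP => // _; exact: prodr_ge0.
  by move=> i _; rewrite /g ltn0 indicE mem_set// /= in_itv; exact: xk.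
pose i0 := Ordinal jd.
pose w k := if P k then \prod_(i | i != i0) g j x k i else 0.
have w0 k : 0 <= w k by rewrite /w; case: ifP => // _; exact: prodr_ge0.
suff : (1 <= \sum_(k <oo) (w k * Num.max 0 (b k i0 - a k i0))%:E)%E.
  move=> /le_trans; apply; apply: lee_nneseries => k _.
    by move=> _; rewrite lee_fin mulr_ge0// le_max lexx.
  rewrite lee_fin /w; case: ifP => _; last by rewrite mul0r.
  rewrite [leRHS](bigD1 i0)//= mulrC {2}/g /= ltnSn.
  rewrite le_eqVlt; apply/orP; left; apply/eqP; congr (_ * _).
  apply: eq_bigr => i ii0; rewrite /g ltnS [in RHS]leq_eqVlt.
  by move: ii0; rewrite -val_eqE /= => /negbTE ->.
apply: unit_interval_cover_sum => // t t01.
(* [x] with its coordinate [j] replaced by the variable of integration. *)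
pose y : 'rV[R]_d := \row_i (if i == i0 then t else x ord0 i).
have /(IH (ltnW jd)) : cube 0%R 1%R y.
  move=> i; rewrite !mxE; case: ifP => // _.
  by have := xbox i; rewrite !mxE.
move=> /le_trans; apply; apply: lee_nneseries => k _.
  by move=> _; rewrite lee_fin; case: ifP => // _; exact: prodr_ge0.
rewrite lee_fin /w; case: ifP => _; last by rewrite mul0r.
rewrite (bigD1 i0)//= mulrC {2}/g /= ltnn mxE eqxx.
rewrite le_eqVlt; apply/orP; left; apply/eqP; congr (_ * _).
by apply: eq_bigr => i /negbTE ii0; rewrite /g mxE ii0.
Qed.

(** The reflected boxes cover the reflected set and have the same volumes. *)
Lemma outer_measure_reflect_le (x : 'rV[R]_d) (N : set 'rV[R]_d) :
  (lebesgue_outer_measure_rV [set y | N (x - y)%R] <= lebesgue_outer_measure_rV N)%E.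
Proof.
apply: le_ereal_inf_tmp => _ [[P c] cov <-] /=.
apply: ereal_inf_lbound; exists (P, fun k => (x - (c k).2, x - (c k).1)) => /=.
  move=> y /cov [k Pk yk]; exists k => // i; rewrite !mxE.
  by have := yk i; rewrite !mxE => /andP[h1 h2]; rewrite lerBlDl -lerBlDr h2 lerBrDl -lerBrDr h1.
apply: eq_eseriesr => k _; congr EFin; apply: eq_bigr => i _.
by congr (Num.max _ _); rewrite !mxE; lra.
Qed.

(** * Boundedness near the origin *)

(** Submultiplicativity turns an essential bound into a bound at every point:
    there are enough ways to write [x] as [y + (x - y)] to avoid the null set
    on which the essential bound fails. *)
Lemma weight_bounded_near0 (v : 'rV[R]_d -> R) :
  weight v -> submultiplicative v ->
  exists B, forall x, cube (-1) 1 x -> v x <= B.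
Proof.
move=> [v0 [_ vloc]] [_ vM].
(* [x - y] stays in this cube for [y] in the unit cube. *)
pose K : set 'rV[R]_d := [set x | forall i, `[(-2)%R, 2%R]%classic (x ord0 i)].
have Kc : compact K by apply: (@rV_compact R d (fun=> `[(-2)%R, 2%R]%classic)) => i; exact: segment_compact.
have [M [N [_ N0 MN]]] := vloc K Kc.
have KM y : K y -> ~ N y -> v y <= M.
  move=> Ky nNy; apply: contrapT => h; apply: nNy; apply: MN => /= /(_ Ky) h2.
  by apply: h; rewrite (le_trans (ler_norm _)).
exists (M * M) => x xbox.
have [y [yc nNy nNxy]] : exists y, [/\ cube 0%R 1%R y,
    ~ N y & ~ N (x - y)%R].
  apply: contrapT => h.
  suff : (1 <= (0 : \bar R))%E by rewrite lee_fin ler10.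
  apply: (le_trans unit_cube_outer_measure_ge1).
  apply: (@le_trans _ _ (lebesgue_outer_measure_rV (N `|` [set y | N (x - y)%R]))).
    apply: le_lebesgue_outer_measure_rV => y yc.
    apply: contrapT => /not_orP[h1 h2].
    by apply: h; exists y.
  have N0' : lebesgue_outer_measure_rV N = 0%E by exact: N0.
  apply: (@le_trans _ _ (lebesgue_outer_measure_rV N +
      lebesgue_outer_measure_rV [set y | N (x - y)%R])%E).
    exact: outer_measureU2.
  by rewrite -[leRHS]N0' [X in (X + _)%E]N0' add0e outer_measure_reflect_le.
have vy : v y <= M.
  apply: KM nNy => i; rewrite /= in_itv /=.
  by have := yc i; rewrite !mxE => /andP[h1 h2]; apply/andP; split; lra.
have vxy : v (x - y) <= M.
  apply: KM nNxy => i; rewrite /= in_itv /= !mxE.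
  have := yc i; have := xbox i; rewrite !mxE => /andP[h1 h2] /andP[h3 h4].
  by apply/andP; split; lra.
rewrite -(subrK y x) (le_trans (vM _ _))// ler_pM// ltW//.
Qed.
End cube_measure.

(** * The Euclidean norm *)

Section euclidean_norm_theory.
Context {R : realType} {d : nat}.

Lemma euclidean_norm_ge0 (x : 'rV[R]_d) : 0 <= euclidean_norm x.
Proof. exact: sqrtr_ge0. Qed.

Lemma le_euclidean_norm (x : 'rV[R]_d) i : `|x ord0 i| <= euclidean_norm x.
Proof.
rewrite -sqrtr_sqr ler_wsqrtr// (bigD1 i)//= lerDl.
by apply: sumr_ge0 => j _; exact: sqr_ge0.
Qed.

Lemma euclidean_normZn n (x : 'rV[R]_d) :
  euclidean_norm (n%:R *: x) = n%:R * euclidean_norm x.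
Proof.
rewrite /euclidean_norm; under eq_bigr do rewrite mxE exprMn.
by rewrite -mulr_sumr sqrtrM ?sqr_ge0// sqrtr_sqr ger0_norm.
Qed.

End euclidean_norm_theory.

(** * Growth of submultiplicative functions *)

Section submult.
Local Open Scope classical_set_scope.
Context {R : realType} {d : nat} {v : 'rV[R]_d -> R}.
Context (v_gt0 : forall x, 0 < v x) (v_submult : submultiplicative v).

Lemma submultiplicative_ge1 x : 1 <= v x.
Proof.
have [vN vM] := v_submult.
have v01 : 1 <= v 0 by have := vM 0 0; rewrite addr0 -{1}[v 0]mulr1 ler_pM2l.
have : 1 <= v x ^+ 2.
  by rewrite (le_trans v01)// -{1}(subrr x) (le_trans (vM _ _))// vN.
by rewrite expr_ge1// ltW.
Qed.

(** Keeping a summand [y] makes this valid for [n = 0] as well, whereas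
    [v (n%:R *: x) <= v x ^+ n] fails there if [v 0 > 1]. *)
Lemma submultiplicative_addMn x y n : v (y + n%:R *: x) <= v y * v x ^+ n.
Proof.
elim: n => [|n IH]; first by rewrite scale0r addr0 expr0 mulr1.
rewrite -natr1 scalerDl scale1r addrA exprSr mulrA.
by rewrite (le_trans (v_submult.2 _ _))// ler_pM2r.
Qed.

(** The factor [v 0] accounts for the empty sum. *)
Lemma submultiplicative_sum (y : 'I_d -> 'rV[R]_d) :
  v (\sum_i y i) <= v 0 * \prod_i v (y i).
Proof.
elim: (index_enum _) => [|i s IH]; first by rewrite !big_nil mulr1.
rewrite !big_cons mulrCA (le_trans (v_submult.2 _ _))//.
by rewrite ler_pM2l.
Qed.

(** Euclidean division of [`|t|] by one fixed [l] at which [v (l%:R *: e)] is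
    small: the quotient gives the exponential, the remainder the constant. *)
Lemma submultiplicative_line_growth (e : 'rV[R]_d) (B delta : R) :
  (forall t, 0 <= t <= 1 -> v (t *: e) <= B) ->
  ((fun l : nat => v (l%:R *: e) `^ l%:R^-1) @ \oo --> (1 : R))%classic ->
  0 < delta ->
  exists2 C : R, 0 < C & forall t, v (t *: e) <= C * expR (delta * `|t|).
Proof.
move=> vB grs delta0.
have [l l0 vl] : exists2 l : nat, (0 < l)%N & v (l%:R *: e) <= expR (delta * l%:R).
  have : \forall l \near \oo, v (l%:R *: e) `^ l%:R^-1 < expR delta.
    by apply: cvgr_lt grs _ _; rewrite expR_gt1.
  case=> N _ HN; exists N.+1 => //.
  have := HN N.+1 (leqnSn N); move=> /ltW /(@ge0_ler_powR _ N.+1%:R (ler0n _ _)).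
  rewrite !nnegrE powR_ge0 expR_ge0 => /(_ isT isT).
  by rewrite -powRrM mulVf// powRr1 ?(ltW (v_gt0 _))// expRM.
have lR : 0 < l%:R :> R by rewrite ltr0n.
have B1 : 1 <= B by rewrite (le_trans (submultiplicative_ge1 (0 *: e)))// vB// lexx ler01.
have B0 : 0 < B by rewrite (lt_le_trans ltr01).
exists (B ^+ l); first exact: exprn_gt0.
move=> t.
have -> : v (t *: e) = v (`|t| *: e).
  by case: ger0P => // _; rewrite scaleNr v_submult.1.
have t0 := normr_ge0 t; move: `|t| t0 => {}t t0.
have := truncn_itv (divr_ge0 t0 (ltW lR)).
set q := Num.truncn _ => /andP[]; rewrite ler_pdivlMr// ltr_pdivrMr// => qt tq.
pose r := t - q%:R * l%:R.
have -> : t *: e = r *: e + q%:R *: (l%:R *: e).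
  by rewrite scalerA -scalerDl subrK.
rewrite (le_trans (submultiplicative_addMn _ _ _))//.
apply: ler_pM; rewrite ?exprn_ge0// ?(ltW (v_gt0 _))//.
  have u01 : 0 <= r / l%:R <= 1.
    rewrite divr_ge0 ?(ltW lR) ?subr_ge0//= ler_pdivrMr// mul1r lerBlDr.
    by rewrite -[X in X + _]mul1r -mulrDl addrC natr1 ltW.
  (* [r *: e] is [l] times a vector of the segment where [B] bounds [v]. *)
  have -> : r *: e = (r / l%:R) *: e + l.-1%:R *: ((r / l%:R) *: e).
    rewrite scalerA -scalerDl; congr (_ *: _).
    by rewrite -{1}[r / _]mul1r -mulrDl addrC natr1 prednK// mulrC divfK// gt_eqF.
  rewrite (le_trans (submultiplicative_addMn _ _ _))// -[in leRHS](prednK l0) exprS.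
  have vu : v ((r / l%:R) *: e) <= B by exact: vB.
  have vu0 := ltW (v_gt0 ((r / l%:R) *: e)).
  by apply: ler_pM; rewrite ?exprn_ge0// lerXn2r// nnegrE ltW.
apply: (@le_trans _ _ (expR (delta * l%:R) ^+ q)).
  by rewrite lerXn2r// ?nnegrE ?expR_ge0// (ltW (v_gt0 _)).
by rewrite -expRM_natl ler_expR mulrCA ler_pM2l.
Qed.

(** For large [l], both [C] and [expR (eps * l * |x|)] are at most
    [(1 + e) ^ (l / 2)] when [eps] is small enough. *)
Lemma GRS_of_subexponential :
  (forall eps : R, 0 < eps ->
     exists2 C : R, 0 < C &
       forall x : 'rV[R]_d, v x <= C * expR (eps * euclidean_norm x)) ->
  GRS_condition v.
Proof.
move=> H x; apply/cvgrPdist_le => e e0.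
(* Half of [ln (1 + e)] absorbs the constant [C], the other half the
   exponential. *)
pose s := ln (1 + e) / 2.
have e1 : 0 < 1 + e by lra.
have s0 : 0 < s by rewrite divr_gt0// ln_gt0// ltrDl.
have n0 := euclidean_norm_ge0 x.
have n1 : 0 < euclidean_norm x + 1 by lra.
have [C C0 vC] := H _ (divr_gt0 s0 n1).
near=> l.
have l0 : (0 < l)%N by near: l; exact: nbhs_infty_gt.
have lC : C / s <= l%:R by near: l; exact: nbhs_infty_ger.
have lR : 0 < l%:R :> R by rewrite ltr0n.
have li : 0 <= (l%:R^-1 : R) by rewrite invr_ge0 ltW.
have lo : 1 <= v (l%:R *: x) `^ l%:R^-1.
  by rewrite -[leLHS]/((fun=> 1) (l%:R^-1 : R)) -powR1 ge0_ler_powR// ?nnegrE ?ler01 ?(ltW (v_gt0 _)) ?submultiplicative_ge1.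
have hi : v (l%:R *: x) `^ l%:R^-1 <= 1 + e.
  have -> : 1 + e = ((1 + e) `^ l%:R) `^ l%:R^-1.
    by rewrite -powRrM mulfV ?gt_eqF// powRr1 ?(ltW e1).
  apply: ge0_ler_powR; rewrite ?nnegrE ?powR_ge0 ?(ltW (v_gt0 _))//.
  rewrite (le_trans (vC _))//.
  have -> : (1 + e) `^ l%:R = expR (l%:R * s) * expR (l%:R * s).
    by rewrite -expRD -mulrDr -splitr -{1}(lnK (x := 1 + e)) -?expRM ?posrE// mulrC.
  apply: ler_pM; rewrite ?expR_ge0 ?(ltW C0)//.
    move: lC; rewrite ler_pdivrMr// => /le_trans; apply.
    by rewrite (le_trans _ (expR_ge1Dx _))// lerDr.
  rewrite ler_expR euclidean_normZn mulrCA ler_pM2l//.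
  by rewrite -mulrA ler_piMr ?(ltW s0)// mulrC ler_pdivrMr// mul1r lerDl.
by rewrite ler_norml; apply/andP; split; lra.
Unshelve. all: by end_near.
Qed.

(** Growth at rate [delta = eps / (d + 1)] along each axis suffices, because
    the coordinates of [x] are at most its Euclidean norm. *)
Lemma subexponential_of_GRS (B : R) :
  (forall x, box (const_mx (-1)) (const_mx 1) x -> v x <= B) ->
  GRS_condition v ->
  forall eps : R, 0 < eps ->
    exists2 C : R, 0 < C &
      forall x : 'rV[R]_d, v x <= C * expR (eps * euclidean_norm x).
Proof.
move=> vB grs eps eps0.
(* [d.+1] rather than [d], which may be 0. *)
pose delta := eps / d.+1%:R.
have delta0 : 0 < delta by rewrite divr_gt0// ltr0n.
have [C CP] : {C : 'I_d -> R & forall i, 0 < C i /\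
    forall t, v (t *: 'e_i) <= C i * expR (delta * `|t|)}.
  apply: (@choice _ _ (fun i C => 0 < C /\ forall t, v (t *: 'e_i) <= C * expR (delta * `|t|))) => i.
  have [] := submultiplicative_line_growth 'e_i B delta _ (grs _) delta0.
    move=> t /andP[t0 t1]; apply: vB => j; rewrite !mxE/=.
    by case: (j == i); rewrite ?mulr1 ?mulr0; apply/andP; split; lra.
  by move=> C C0 HC; exists C.
exists (v 0 * \prod_i C i).
  by rewrite mulr_gt0// prodr_gt0// => i _; exact: (CP i).1.
move=> x; rewrite {1}(row_sum_delta x).
rewrite (le_trans (submultiplicative_sum _))//.
rewrite -mulrA ler_pM2l//.
apply: (@le_trans _ _ (\prod_i (C i * expR (delta * `|x 0 i|)))).
  by apply: ler_prod => i _; rewrite (CP i).2 ltW.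
rewrite big_split /= -expR_sum ler_pM2l; last by rewrite prodr_gt0// => i _; exact: (CP i).1.
rewrite ler_expR -mulr_sumr -mulrA ler_pM2l// mulrC ler_pdivrMr ?ltr0n//.
apply: (@le_trans _ _ (\sum_(i < d) euclidean_norm x)).
  by apply: ler_sum => i _; exact: le_euclidean_norm.
rewrite sumr_const card_ord -[leLHS]mulr_natr ler_wpM2l ?euclidean_norm_ge0//.
by rewrite ler_nat.
Qed.

End submult.

Theorem proposition1 (R : realType) (d : nat) (v : 'rV[R]_d -> R)
    (v_weight : weight v) (v_submult : submultiplicative v) :
  GRS_condition v <->
  (forall eps : R, 0 < eps ->
     exists2 C : R, 0 < C &
       forall x : 'rV[R]_d, v x <= C * expR (eps * euclidean_norm x)).
Proof.
have [B vB] := weight_bounded_near0 _ v_weight v_submult.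
split; first exact: (subexponential_of_GRS v_weight.1 v_submult B).
exact: GRS_of_subexponential v_weight.1 v_submult.
Qed.
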